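(* Let $\mathcal{A}$ be an algebra such that $N(\mathcal{A})$ and $N_c(\mathcal{A})$ are both singletons. Then: (i) $N(\mathcal{A} \times_0 \mathbb{C})$ is a singleton; (ii) the co-dimension of $\mathcal{A}^2$ in $\mathcal{A}$ is finite; (iii) if $\mathcal{A}^2$ is dense in $\mathcal{A}$, then $\mathcal{A}^2 = \mathcal{A}$.
   Context: Algebras are associative algebras over $\mathbb{C}$ (not assumed unital or commutative). An algebra norm on an algebra $\mathcal{A}$ is a vector space norm $\|\cdot\|$ on $\mathcal{A}$ that is submultiplicative, i.e. $\|ab\| \le \|a\|\|b\|$ for all $a,b \in \mathcal{A}$ (completeness is not required). $N(\mathcal{A})$ denotes the set of equivalence classes of all algebra norms on $\mathcal{A}$, and $N_c(\mathcal{A})$ the set of equivalence classes of all complete algebra norms (Banach algebra norms) on $\mathcal{A}$, where two norms are identified if they are equivalent (induce the same topology). When $N(\mathcal{A})$ is a singleton, density in $\mathcal{A}$ refers to the unique topology induced by algebra norms on $\mathcal{A}$. $\mathcal{A}^2 = \operatorname{span}\{ab : a,b \in \mathcal{A}\}$, and its co-dimension is the dimension of the vector space $\mathcal{A}/\mathcal{A}^2$. The null product algebra $\mathcal{A} \times_0 \mathbb{C}$ is the vector space $\mathcal{A} \times \mathbb{C}$ with coordinatewise linear operations and the product $(a,\alpha) \times_0 (b,\beta) = (ab, 0)$. *)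

(* Defs.v *)
From HB Require Import structures.
From mathcomp Require Import all_boot all_order all_algebra.
From mathcomp Require Import generic_quotient ring_quotient.
From mathcomp Require Import complex.
From mathcomp Require Import all_classical all_reals topology normedtype.

Set Implicit Arguments.
Unset Strict Implicit.
Unset Printing Implicit Defensive.

Import Order.TTheory GRing.Theory Num.Theory.
Import numFieldNormedType.Exports.

Local Open Scope classical_set_scope.
Local Open Scope complex_scope.
Local Open Scope ring_scope.

(* Algebras in ssralg are unital, so associative algebras without a unit are
   introduced on top of left modules. *)
HB.mixin Record Lmodule_isAssocAlgebra (K : fieldType) A & GRing.Lmodule K A := {
  amul : A -> A -> A;
  amulA : associative amul;
  amulDl : left_distributive amul +%R;
  amulDr : right_distributive amul +%R;
  amulZl : forall (k : K) (a b : A), amul (k *: a) b = k *: amul a b;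
  amulZr : forall (k : K) (a b : A), amul a (k *: b) = k *: amul a b
}.

#[short(type="assocAlgType")]
HB.structure Definition AssocAlgebra (K : fieldType) :=
  {A of GRing.Lmodule K A & Lmodule_isAssocAlgebra K A}.

Section LinearSpan.
Variables (K : fieldType) (V : lmodType K).

Definition lspan (S : set V) : set V :=
  [set x | exists (n : nat) (c : 'I_n -> K) (v : 'I_n -> V),
     (forall i, S (v i)) /\ x = \sum_i c i *: v i].

Definition finite_dimensional : Prop :=
  exists s : seq V, lspan [set` s] = [set: V].

(* Boolean version of [lspan], as required by quotients in ring_quotient. *)
Definition lspanb (S : set V) : {pred V} := fun x => `[< lspan S x >].

Lemma lspanb_submod_closed (S : set V) : submod_closed (lspanb S).
Proof.
split=> [|k x y]; rewrite ?unfold_in.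
  apply/asboolP; exists 0, (fun=> 0), (fun=> 0); split; first by case.
  by rewrite big_ord0.
move=> /asboolP[n [c [v [Sv ->]]]] /asboolP[m [d [w [Sw ->]]]].
apply/asboolP; exists (n + m)%N.
exists (fun i : 'I_(n + m) => match fintype.split i with inl j => k * c j | inr j => d j end).
exists (fun i : 'I_(n + m) => match fintype.split i with inl j => v j | inr j => w j end).
split=> [i|]; first by case: (fintype.split i).
rewrite big_split_ord /= scaler_sumr; congr (_ + _); apply: eq_bigr => i _.
  by rewrite -[lshift _ _]/(unsplit (inl i)) unsplitK scalerA.
by rewrite -[rshift _ _]/(unsplit (inr i)) unsplitK.
Qed.

HB.instance Definition _ (S : set V) :=
  GRing.isSubmodClosed.Build K V (lspanb S)
    (GRing.submod_closed_semi (lspanb_submod_closed S)).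

End LinearSpan.

(* The quotient of [V] by the subspace spanned by [S]: ring_quotient provides the
   additive group, and the scaling is added here. *)
Section LmodQuotient.
Variables (K : fieldType) (V : lmodType K) (S : set V).

Local Notation W := (lspanb S).

Definition lquot : Type := Quotient.quot W.

HB.instance Definition _ := GRing.Zmodule.on lquot.

Definition lquot_pi (x : V) : lquot := (\pi_(Quotient.quot W) x)%qT.

Definition lquot_scale (k : K) (q : lquot) : lquot :=
  lquot_pi (k *: repr (q : Quotient.quot W)).

Lemma lquot_piP (x y : V) : reflect (lquot_pi x = lquot_pi y) (x - y \in W).
Proof. by rewrite Quotient.idealrBE; apply: eqP. Qed.

Lemma lquot_piD : {morph lquot_pi : x y / x + y}.
Proof. by move=> x y; rewrite /lquot_pi raddfD. Qed.

Lemma lquot_piZ (k : K) (x : V) : lquot_pi (k *: x) = lquot_scale k (lquot_pi x).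
Proof.
apply/lquot_piP; rewrite -scalerBr rpredZ//; apply/lquot_piP.
by rewrite /lquot_pi reprK.
Qed.

Lemma lquot_piE (q : lquot) : exists x, q = lquot_pi x.
Proof. by exists (repr (q : Quotient.quot W)); rewrite /lquot_pi reprK. Qed.

Lemma lquot_scaleA k l q :
  lquot_scale k (lquot_scale l q) = lquot_scale (k * l) q.
Proof. by have [x ->] := lquot_piE q; rewrite -!lquot_piZ scalerA. Qed.

Lemma lquot_scale1 : left_id 1 lquot_scale.
Proof. by move=> q; have [x ->] := lquot_piE q; rewrite -lquot_piZ scale1r. Qed.

Lemma lquot_scaleDr : right_distributive lquot_scale +%R.
Proof.
move=> k p q; have [x ->] := lquot_piE p; have [y ->] := lquot_piE q.
by rewrite -lquot_piD -!lquot_piZ scalerDr lquot_piD.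
Qed.

Lemma lquot_scaleDl q : {morph lquot_scale^~ q : k l / k + l}.
Proof.
move=> k l; have [x ->] := lquot_piE q.
by rewrite -!lquot_piZ scalerDl lquot_piD.
Qed.

HB.instance Definition _ := GRing.Zmodule_isLmodule.Build K lquot
  lquot_scaleA lquot_scale1 lquot_scaleDr lquot_scaleDl.

End LmodQuotient.

Section AlgebraSquare.
Variables (K : fieldType) (A : assocAlgType K).

Definition products : set A := [set amul a b | a in [set: A] & b in [set: A]].

Definition alg_square : set A := lspan products.

(* [A / A^2] is finite dimensional. *)
Definition finite_codim_square : Prop :=
  finite_dimensional (lquot products).

End AlgebraSquare.

Arguments products {K} A.
Arguments alg_square {K} A.

Section NullProduct.
Variables (K : fieldType) (A : assocAlgType K).

Definition null_product : Type := (A * K^o)%type.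

HB.instance Definition _ := GRing.Lmodule.on null_product.

Definition null_mul (x y : null_product) : null_product := (amul x.1 y.1, 0).

Lemma null_mulA : associative null_mul.
Proof. by move=> x y z; rewrite /null_mul amulA. Qed.

Lemma null_mulDl : left_distributive null_mul +%R.
Proof. by move=> x y z; congr (_, _); rewrite /= ?amulDl ?addr0. Qed.

Lemma null_mulDr : right_distributive null_mul +%R.
Proof. by move=> x y z; congr (_, _); rewrite /= ?amulDr ?addr0. Qed.

Lemma null_mulZl k x y : null_mul (k *: x) y = k *: null_mul x y.
Proof. by congr (_, _); rewrite /= ?amulZl ?scaler0. Qed.

Lemma null_mulZr k x y : null_mul x (k *: y) = k *: null_mul x y.
Proof. by congr (_, _); rewrite /= ?amulZr ?scaler0. Qed.

HB.instance Definition _ := Lmodule_isAssocAlgebra.Build K null_product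
  null_mulA null_mulDl null_mulDr null_mulZl null_mulZr.

End NullProduct.

Section AlgebraNorms.
Variables (R : realType) (A : assocAlgType R[i]).

Record algebra_norm := AlgebraNorm {
  anorm :> A -> R;
  anorm_eq0 : forall a, anorm a = 0 -> a = 0;
  anormD : forall a b, anorm (a + b) <= anorm a + anorm b;
  anormZ : forall (k : R[i]) a, (anorm (k *: a))%:C = `|k| * (anorm a)%:C;
  anormM : forall a b, anorm (amul a b) <= anorm a * anorm b
}.

(* [A] with the topology and uniformity of an algebra norm; the library takes
   norms on a complex vector space to be valued in the scalar field. *)
Definition normed_by (N : algebra_norm) : Type := A.

Section NormedBy.
Variable N : algebra_norm.

HB.instance Definition _ := GRing.Lmodule.on (normed_by N).

Definition cnorm (a : normed_by N) : R[i] := (N a)%:C.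

Lemma cnormD a b : cnorm (a + b) <= cnorm a + cnorm b.
Proof. by rewrite /cnorm -rmorphD lecR anormD. Qed.

Lemma cnormZ (k : R[i]) a : cnorm (k *: a) = `|k| * cnorm a.
Proof. exact: anormZ. Qed.

Lemma cnorm_eq0 a : cnorm a = 0 -> a = 0.
Proof. by move=> /complexI /anorm_eq0. Qed.

HB.instance Definition _ := Lmodule_isNormed.Build R[i] (normed_by N)
  cnormD cnormZ cnorm_eq0.

End NormedBy.

Definition norm_equiv (N M : algebra_norm) : Prop :=
  forall U : set A, open (U : set (normed_by N)) <-> open (U : set (normed_by M)).

Definition norm_complete (N : algebra_norm) : Prop :=
  forall F : set_system (normed_by N), ProperFilter F -> cauchy F -> cvg F.

Definition norm_classes (P : set algebra_norm) : set (set algebra_norm) :=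
  [set [set M | P M /\ norm_equiv N M] | N in P].

Definition alg_norms : set (set algebra_norm) := norm_classes [set: algebra_norm].

Definition complete_alg_norms : set (set algebra_norm) :=
  norm_classes [set N | norm_complete N].

End AlgebraNorms.

Arguments alg_norms {R} A.
Arguments complete_alg_norms {R} A.

Definition is_singleton (T : Type) (S : set T) : Prop := exists x, S = [set x].

(* Main.v *)
From HB Require Import structures.
Require Import Defs.
From mathcomp Require Import all_boot all_order all_algebra.
From mathcomp Require Import complex.
From mathcomp Require Import all_classical all_reals topology normedtype.
From mathcomp Require Import interval_inference.

(**
If [f] is a linear functional on [A] vanishing on [A^2] and [N] is an algebra
norm, then [a |-> N a + |f a|] is again an algebra norm; so when all algebra
norms on [A] are equivalent, every such functional is continuous. Linear
functionals on [A / A^2], extended by Zorn's lemma, then give the last two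
claims: an infinite-dimensional quotient would carry an unbounded functional,
and a nonzero functional vanishing on a dense subspace cannot be continuous.

For the null product, an algebra norm restricts to a norm on [A] which is
equivalent to the complete one. Hence [A] is a closed hyperplane, the second
projection is continuous, and the norm is equivalent to [N a + |alpha|].
*)

Set Implicit Arguments.
Unset Strict Implicit.
Unset Printing Implicit Defensive.

Import Order.TTheory GRing.Theory Num.Theory.
Import numFieldNormedType.Exports.

Local Open Scope classical_set_scope.
Local Open Scope complex_scope.
Local Open Scope ring_scope.

(** * Extension of partially defined linear functionals *)

Section LinearExtension.
Variables (K : fieldType) (V : lmodType K).

(** A partial functional is encoded by its graph, a subspace of [V * K^o] meeting the vertical axis
    only in [0], so that Zorn's lemma applies to sets ordered by inclusion. *)
Definition linear_graph (G : set (V * K^o)) : Prop :=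
  [/\ G 0, forall k u v, G u -> G v -> G (k *: u + v) &
      forall y, G (0, y) -> y = 0].

Lemma linear_graph_unique (G : set (V * K^o)) x y z :
  linear_graph G -> G (x, y) -> G (x, z) -> y = z.
Proof.
move=> [_ GD Gf] Gy Gz; apply/eqP; rewrite -subr_eq0 addrC -scaleN1r.
apply/eqP/Gf; rewrite (_ : (0, _) = -1 *: (x, z) + (x, y) :> V * K^o).
  exact: GD.
by congr (_, _); rewrite /= scaleN1r addNr.
Qed.

Lemma linear_graph_total_functional (G : set (V * K^o)) :
  linear_graph G -> (forall x, exists y, G (x, y)) ->
  exists f : {scalar V}, forall x, G (x, f x).
Proof.
move=> Ggr /choice[f Gxf].
have flin : scalar f.
  move=> k x y; apply: linear_graph_unique (Gxf _) _ => //.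
  have [_ GD _] := Ggr; exact: (GD k (x, f x) (y, f y)).
pose f' : {scalar V} := HB.pack f (GRing.isLinear.Build K V K *%R f flin).
by exists f'.
Qed.

(** A maximal linear graph above [G] is total: over a point missing from its domain, a further line
    could be adjoined. *)
Lemma linear_graph_extension (G : set (V * K^o)) :
  linear_graph G ->
  exists f : {scalar V}, forall x y, G (x, y) -> f x = y.
Proof.
move=> Ggr; have [G0 GD Gf] := Ggr.
(* Joining [G] to every candidate takes care of the empty chain and makes the maximal graph extend
   [G]. *)
have [F FP totF|A [Agr Amax]] :=
    Zorn_bigcup (P := [set X | linear_graph (G `|` X)]).
  (* Two elements of the union already lie in a single linear graph inside it, and each closure
     condition involves at most two elements. *)
  have pairP u v : (G `|` \bigcup_(X in F) X) u ->
      (G `|` \bigcup_(X in F) X) v ->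
    exists X, [/\ linear_graph (G `|` X), (G `|` X) u, (G `|` X) v &
      G `|` X `<=` G `|` \bigcup_(X in F) X].
    have subF X : F X -> G `|` X `<=` G `|` \bigcup_(X in F) X.
      by move=> FX; apply: setUS; apply: bigcup_sup.
    move=> [Gu|[X FX Xu]] [Gv|[Y FY Yv]].
    - by exists set0; rewrite setU0; split=> //; apply: subsetUl.
    - by exists Y; split; [exact: FP|left|right|exact: subF].
    - by exists X; split; [exact: FP|right|left|exact: subF].
    - have [XY|YX] := totF _ _ FX FY.
        by exists Y; split; [exact: FP|right; exact: XY|right|exact: subF].
      by exists X; split; [exact: FP|right|right; exact: YX|exact: subF].
  split; first by left.
    move=> k u v /pairP/[apply] -[X [[_ XD _] Xu Xv +]]; apply.
    exact: XD.
  by move=> y Uy; have [X [[_ _ Xf] /Xf]] := pairP _ _ Uy Uy.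
set H := G `|` A in Agr; have [H0 HD Hf] := Agr.
have [x|f Hfx] := linear_graph_total_functional Agr.
  apply: contrapT => /forallNP noy.
  (* [B] adjoins to [H] the value [0] at [x], so it strictly contains [A]. *)
  pose B := [set u : V * K^o |
    exists g k, H g /\ u = k *: ((x, 0) : V * K^o) + g].
  have HB : H `<=` B by move=> u Hu; exists u, 0; rewrite scale0r add0r.
  have GBE : G `|` B = B.
    by apply/setUidPr => u Gu; apply: HB; left.
  have Bx : B (x, 0) by exists 0, 1; rewrite scale1r addr0.
  apply: (Amax B) => /=.
    split; first by move=> u Au; apply: HB; right.
    by move=> /(_ _ Bx) Ax; apply: (noy 0); right.
  rewrite GBE; split; first exact: HB.
    move=> k _ _ [g [a [Hg ->]]] [h [b [Hh ->]]].
    exists (k *: g + h), (k * a + b); split; first exact: HD.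
    by rewrite scalerDr scalerA scalerDl addrACA.
  move=> y [[g1 g2] [k [Hg [/eqP + yE]]]].
  rewrite eq_sym addrC addr_eq0 => /eqP g1E.
  rewrite scaler0 add0r in yE; subst g1 g2.
  have [k0|k0] := eqVneq k 0.
    by apply: Hf; move: Hg; rewrite k0 scale0r oppr0.
  (* Here [H] contains [(- (k *: x), y)] with [k] nonzero; dividing by [- k] would give [x] a value
     in [H]. *)
  case: (noy (- k^-1 * y)).
  rewrite (_ : (x, _) = - k^-1 *: ((- (k *: x), y) : V * K^o) + 0).
    exact: HD.
  rewrite addr0; congr (_, _).
  by rewrite /= scalerN scaleNr opprK scalerA mulVf// scale1r.
exists f => x y Gxy; apply: (linear_graph_unique Agr (Hfx x)); left.
exact: Gxy.
Qed.

(* The sequence [e] may be linearly dependent; it is constant in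
   [functional_nonzero]. *)
Lemma functional_with_values (e : nat -> V) (w : nat -> K) :
  (forall n (c : nat -> K),
     \sum_(i < n) c i *: e i = 0 -> \sum_(i < n) c i * w i = 0) ->
  exists f : {scalar V}, forall n, f (e n) = w n.
Proof.
move=> rel.
(* This relation lives over the span of [e]; the hypothesis [rel] is what makes it single-valued. *)
pose G := [set u : V * K^o | exists n (c : nat -> K),
  u = (\sum_(i < n) c i *: e i, \sum_(i < n) c i * w i)].
(* Zero coefficients bring two combinations to a common length before they are added. *)
have pad n m (c : nat -> K) : (n <= m)%N -> exists d : nat -> K,
    \sum_(i < n) c i *: e i = \sum_(i < m) d i *: e i /\
    \sum_(i < n) c i * w i = \sum_(i < m) d i * w i.
  move=> nm; exists (fun i => if (i < n)%N then c i else 0); split.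
    rewrite (big_ord_widen _ (fun i => c i *: e i) nm) big_mkcond/=.
    by apply: eq_bigr => i _; case: ifP => // _; rewrite scale0r.
  rewrite (big_ord_widen _ (fun i => c i * w i) nm) big_mkcond/=.
  by apply: eq_bigr => i _; case: ifP => // _; rewrite mul0r.
have [|f Gf] := @linear_graph_extension G.
  split.
  - by exists 0, (fun=> 0); rewrite !big_ord0.
  - move=> k _ _ [n [c ->]] [m [d ->]].
    have [c' [-> ->]] := pad _ _ c (leq_maxl n m).
    have [d' [-> ->]] := pad _ _ d (leq_maxr n m).
    exists (maxn n m), (fun i => k * c' i + d' i); congr (_, _) => /=.
      rewrite scaler_sumr -big_split; apply: eq_bigr => i _ /=.
      by rewrite scalerDl scalerA.
    rewrite scaler_sumr -big_split; apply: eq_bigr => i _ /=.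
    by rewrite mulrDl -mulrA.
  - by move=> y [n [c [/esym/rel rel0 ->]]].
exists f => n; apply: Gf; exists n.+1, (fun i => (i == n)%:R).
have in_lt (i : 'I_n) : ((i : nat) == n) = false by rewrite ltn_eqF.
rewrite !big_ord_recr /= eqxx scale1r mul1r !big1 ?add0r//.
  by move=> i _; rewrite in_lt mul0r.
by move=> i _; rewrite in_lt scale0r.
Qed.

Lemma functional_nonzero (x : V) : x != 0 -> exists f : {scalar V}, f x = 1.
Proof.
move=> x0; have [n c|f fx] := @functional_with_values (fun=> x) (fun=> 1).
  rewrite -scaler_suml => /eqP; rewrite scaler_eq0 (negPf x0) orbF => /eqP.
  by under [X in _ -> X = _]eq_bigr do rewrite mulr1.
by exists f; exact: fx 0.
Qed.

(** Choosing each vector outside the span of the previous ones gives an independent sequence, on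
    which any values are consistent. *)
Lemma functional_prescribed_on_infinite_dimensional :
  ~ finite_dimensional V ->
  exists e : nat -> V, forall w : nat -> K,
    exists f : {scalar V}, forall n, f (e n) = w n.
Proof.
move=> Vinf.
have /choice[g gP] (s : seq V) : exists x, ~ lspan [set` s] x.
  apply: contrapT => /forallNP sV; apply: Vinf; exists s.
  by rewrite -subTset => x _; apply: contrapT; exact: sV.
pose s := fix s n := if n is m.+1 then g (s m) :: s m else [::].
pose e n := g (s n); exists e => w.
have mem_s n i : (i < n)%N -> e i \in s n.
  elim: n => // n IHn; rewrite ltnS leq_eqVlt inE => /orP[/eqP ->|/IHn ->].
    by rewrite eqxx.
  by rewrite orbT.
have indep n (c : nat -> K) :
    \sum_(i < n) c i *: e i = 0 -> forall i, (i < n)%N -> c i = 0.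
  elim: n => // n IHn; rewrite big_ord_recr /=.
  have [cn0|cn0 sum0] := eqVneq (c n) 0.
    rewrite cn0 scale0r addr0 => /IHn c0 i.
    by rewrite ltnS leq_eqVlt => /orP[/eqP ->|]; [|exact: c0].
  (* With [c n] nonzero, solving for [e n] puts it in the span of [s n], against the choice of
     [g]. *)
  case: (gP (s n)); exists n, (fun i => - (c n)^-1 * c i), (fun i => e i).
  split=> [i|]; first exact: mem_s.
  under eq_bigr do rewrite -scalerA.
  rewrite -scaler_sumr scaleNr -scalerN.
  move/eqP: sum0; rewrite addrC addr_eq0 => /eqP <-.
  by rewrite scalerA mulVf// scale1r.
apply: functional_with_values => n c /indep c0.
by apply: big1 => i _; rewrite c0// mul0r.
Qed.

End LinearExtension.

Lemma gt0_complexE (R : rcfType) (e : R[i]) :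
  0 < e -> exists2 r : R, 0 < r & e = r%:C.
Proof.
by case: e => r i; rewrite ltcE /= => /andP[/eqP -> r0]; exists r.
Qed.

(** * Algebra norms: domination, equivalence and completeness *)

Section AlgebraNormTheory.
Variables (R : realType) (A : assocAlgType R[i]).
Implicit Types (N M P : algebra_norm A) (a b : A).

Lemma anorm_normr N a : (N a)%:C = `|a : normed_by N|.
Proof. by []. Qed.

Lemma anorm_ge0 N a : 0 <= N a.
Proof. by rewrite -lecR anorm_normr normr_ge0. Qed.

Lemma anorm0 N : N 0 = 0.
Proof. by apply: complexI; rewrite anorm_normr normr0. Qed.

Lemma anormN N a : N (- a) = N a.
Proof. by apply: complexI; rewrite !anorm_normr normrN. Qed.

Lemma anormZ_real N (r : R) a : 0 <= r -> N (r%:C *: a) = r * N a.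
Proof.
by move=> r0; apply: complexI; rewrite anormZ ger0_norm ?ler0c// rmorphM.
Qed.

Lemma open_anormP N (U : set A) :
  open (U : set (normed_by N)) <->
  forall a, U a -> exists2 e : R, 0 < e & forall b, N (a - b) < e -> U b.
Proof.
rewrite openE; split=> oU a Ua.
  have /nbhs_normP[e /= e0 eU] := oU a Ua.
  have [r r0 eE] := gt0_complexE e0.
  exists r => // b Nab; apply: eU.
  by rewrite /= eE -[`|_|]/((N (a - b))%:C) ltcR.
have [e e0 eU] := oU a Ua.
apply/nbhs_normP; exists e%:C; first by rewrite /= ltcR.
move=> b; rewrite /= -[`|_|]/((N (a - b))%:C) ltcR.
exact: eU.
Qed.

Lemma norm_equiv_sym N M : norm_equiv N M -> norm_equiv M N.
Proof. by move=> NM U; split=> /NM. Qed.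

Lemma norm_equiv_trans N M P :
  norm_equiv N M -> norm_equiv M P -> norm_equiv N P.
Proof. by move=> NM MP U; split=> [/NM/MP|/MP/NM]. Qed.

(** The unit ball of [N] is open for [M], hence contains an [M]-ball around [0]; homogeneity turns
    this inclusion into a bound. *)
Lemma norm_equiv_dominated N M :
  norm_equiv N M -> exists2 C : R, 0 < C & forall a, N a <= C * M a.
Proof.
move=> NM.
have /open_anormP/(_ 0)[|e e0 eU] :
    open ([set a | N a < 1] : set (normed_by M)).
  apply/NM/open_anormP => a /= Na1; exists (1 - N a); first by rewrite subr_gt0.
  move=> b; rewrite ltrBrDl => Nab; apply: le_lt_trans Nab.
  rewrite -(anormN N (a - b)) opprB -[X in N X <= _](subrK a).
  by rewrite [b - a + a]addrC anormD.
  by rewrite /= anorm0.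
have {}eU b : M b < e -> N b < 1.
  by move=> Mb; apply: eU; rewrite sub0r anormN.
(* The vector is rescaled below to [M]-norm [e / 2]; the factor 2 keeps it strictly inside the open
   ball. *)
exists (2 / e); first by rewrite divr_gt0.
move=> a; have [M0|Mn0] := eqVneq (M a) 0.
  by rewrite (anorm_eq0 M0) !anorm0 mulr0.
have Ma0 : 0 < M a by rewrite lt_neqAle eq_sym Mn0 anorm_ge0.
pose r := e / (2 * M a).
have r0 : 0 < r by rewrite divr_gt0// mulr_gt0.
have : N (r%:C *: a) < 1.
  apply: eU; rewrite anormZ_real ?ltW// /r invfM mulrA mulfVK//.
  by rewrite ltr_pdivrMr// ltr_pMr// ltr1n.
rewrite anormZ_real ?(ltW r0)// mulrC -ltr_pdivlMr// mul1r /r invf_div => /ltW.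
by rewrite mulrAC.
Qed.

Lemma dominated_open N M (C : R) (U : set A) :
  0 < C -> (forall a, N a <= C * M a) ->
  open (U : set (normed_by N)) -> open (U : set (normed_by M)).
Proof.
move=> C0 NM /open_anormP oU; apply/open_anormP => a /oU[e e0 eU].
exists (e / C); first by rewrite divr_gt0.
move=> b; rewrite ltr_pdivlMr// mulrC => Mab; apply: eU.
exact: le_lt_trans Mab.
Qed.

Lemma norm_equiv_of_dominated N M (C D : R) : 0 < C -> 0 < D ->
  (forall a, N a <= C * M a) -> (forall a, M a <= D * N a) -> norm_equiv N M.
Proof.
move=> C0 D0 NM MN U; split; first exact: dominated_open NM.
exact: dominated_open MN.
Qed.

Lemma is_singleton_norm_classesP (S : set (algebra_norm A)) :
  is_singleton (norm_classes S) <->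
  (exists N, S N) /\ forall N M, S N -> S M -> norm_equiv N M.
Proof.
split=> [[c cE]|[[N SN] Seq]].
  have classE N : S N -> [set M | S M /\ norm_equiv N M] = c.
    move=> SN; rewrite -[_ = c]/([set c] [set M | S M /\ norm_equiv N M]) -cE.
    by exists N.
  have [N0 SN0 _] : norm_classes S c by rewrite cE.
  split; first by exists N0.
  move=> N M SN SM.
  have : [set P | S P /\ norm_equiv M P] M by split.
  by rewrite (classE M)// -(classE N)// => -[].
(* All members of [S] being equivalent, each has [S] itself as its class. *)
exists S; rewrite eqEsubset; split=> [_ [M SM <-]|_ ->] /=.
  by rewrite eqEsubset; split=> [P []|P SP] //=; split=> //; exact: Seq.
exists N => //; rewrite eqEsubset; split=> [P []|P SP] //=.
by split=> //; exact: Seq.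
Qed.

(** Sequential form of completeness with real radii. The tail is only required to stay near one term
    [u k], which suffices for a Cauchy filter. *)
Lemma norm_complete_seq N (u : nat -> A) : norm_complete N ->
  (forall e : R, 0 < e ->
     exists k, forall n, (k <= n)%N -> N (u k - u n) < e) ->
  exists a, forall e : R, 0 < e ->
    exists k, forall n, (k <= n)%N -> N (a - u n) < e.
Proof.
move=> Ncomp ucau; pose v : nat -> normed_by N := u.
have : cvg (v @ \oo).
  apply: Ncomp; apply: cauchy_exP => e e0.
  have [r /ucau[k uk] eE] := gt0_complexE e0.
  exists (v k); exists k => // n /= /uk ukn.
  by rewrite -ball_normE /= eE -[`|_|]/((N (u k - u n))%:C) ltcR.
move=> /cvg_ex[a /cvgrPdist_lt va]; exists a => e e0.
have /va[k _ kP] : 0 < e%:C by rewrite ltcR.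
by exists k => n /kP /=; rewrite -[`|_|]/((N (a - u n))%:C) ltcR.
Qed.

(** Adding [|f|] preserves submultiplicativity because [f] vanishes on products. The base [p] is
    only a seminorm, so as to cover the null product, where [p] ignores the second coordinate. *)
Lemma seminorm_add_functional (p : A -> R) (f : A -> R[i]) :
  (forall a, 0 <= p a) ->
  (forall a b, p (a + b) <= p a + p b) ->
  (forall (k : R[i]) a, (p (k *: a))%:C = `|k| * (p a)%:C) ->
  (forall a b, p (amul a b) <= p a * p b) ->
  scalar f -> (forall a b, f (amul a b) = 0) ->
  (forall a, p a = 0 -> f a = 0 -> a = 0) ->
  exists M : algebra_norm A,
    forall a, M a = p a + ComplexField.Normc.normc (f a).
Proof.
move=> p0 pD pZ pM flin fM pf0.
pose f' : {scalar A} := HB.pack f (GRing.isLinear.Build R[i] A R[i] *%R f flin).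
pose q a := p a + ComplexField.Normc.normc (f a).
have fD a b : f (a + b) = f a + f b := linearD f' a b.
have fZ k a : f (k *: a) = k * f a := linearZ_LR f' k a.
have normcE (z : R[i]) : (ComplexField.Normc.normc z)%:C = `|z| by [].
have normc_ge0 (z : R[i]) : 0 <= ComplexField.Normc.normc z.
  by rewrite -lecR normcE normr_ge0.
have q0 a : q a = 0 -> a = 0.
  move/eqP; rewrite /q paddr_eq0// => /andP[/eqP pa /eqP fa].
  by apply: pf0 => //; apply: ComplexField.Normc.eq0_normc.
have qD a b : q (a + b) <= q a + q b.
  rewrite /q addrACA lerD// -lecR rmorphD /= !normcE fD.
  exact: ler_normD.
have qZ (k : R[i]) a : (q (k *: a))%:C = `|k| * (q a)%:C.
  by rewrite /q !rmorphD /= pZ !normcE fZ normrM mulrDr.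
have qM a b : q (amul a b) <= q a * q b.
  rewrite /q /= fM ComplexField.Normc.normc0 addr0 (le_trans (pM _ _))//.
  by rewrite ler_pM// lerDl.
by exists (AlgebraNorm q0 qD qZ qM).
Qed.

End AlgebraNormTheory.

(** * The quotient by [A^2] and functionals vanishing on [A^2] *)

Lemma lquot_pi_eq0 (K : fieldType) (V : lmodType K) (S : set V) (x : V) :
  lquot_pi S x = 0 <-> lspan S x.
Proof.
have <- : lquot_pi S 0 = 0 by rewrite /lquot_pi raddf0.
split=> [/lquot_piP|Sx]; first by rewrite subr0 => /asboolP.
by apply/lquot_piP; rewrite subr0; apply/asboolP.
Qed.

Lemma lspan_subset (K : fieldType) (V : lmodType K) (S : set V) :
  S `<=` lspan S.
Proof.
move=> x Sx; exists 1, (fun=> 1), (fun=> x); split=> //.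
by rewrite big_ord1 scale1r.
Qed.

Section FunctionalsVanishingOnSquare.
Variables (R : realType) (A : assocAlgType R[i]).

(** The algebra norm [N + |f|], equivalent to [N] by assumption, is bounded by a multiple of [N]. *)
Lemma functional_vanishing_on_products_bounded (N : algebra_norm A)
    (f : A -> R[i]) :
  (forall M M' : algebra_norm A, norm_equiv M M') ->
  scalar f -> (forall a b, f (amul a b) = 0) ->
  exists2 C : R, 0 < C & forall a, `|f a| <= (C * N a)%:C.
Proof.
move=> allequiv flin fM.
have [||||a Na0 _|M ME] := seminorm_add_functional (p := N) _ _ _ _ flin fM.
- exact: anorm_ge0.
- exact: anormD.
- exact: anormZ.
- exact: anormM.
- exact: anorm_eq0 Na0.
have [C C0 CP] := norm_equiv_dominated (allequiv M N).
exists C => // a; rewrite -[`|_|]/((ComplexField.Normc.normc _)%:C) lecR.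
by rewrite (le_trans _ (CP a))// ME lerDr anorm_ge0.
Qed.

Lemma lquot_functional_bounded (N : algebra_norm A)
    (f : {scalar lquot (products A)}) :
  (forall M M' : algebra_norm A, norm_equiv M M') ->
  exists2 C : R, 0 < C & forall a, `|f (lquot_pi _ a)| <= (C * N a)%:C.
Proof.
move=> allequiv.
apply: (functional_vanishing_on_products_bounded N) => // [k a b|a b].
  by rewrite lquot_piD lquot_piZ linearP.
rewrite (_ : lquot_pi _ _ = 0) ?linear0//.
by apply/lquot_pi_eq0/lspan_subset; exists a => //; exists b.
Qed.

Lemma finite_codim_square_of_equiv (N : algebra_norm A) :
  (forall M M' : algebra_norm A, norm_equiv M M') -> finite_codim_square A.
Proof.
move=> allequiv; apply: contrapT.
move=> /functional_prescribed_on_infinite_dimensional[e eP].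
have /choice[a aP] n := lquot_piE (e n).
(* The summand 1 handles the indices where [N (a n) = 0]. *)
have [f fe] := eP (fun n => (n%:R * N (a n) + 1)%:C).
have [C C0 fC] := lquot_functional_bounded N f allequiv.
(* An index [n > C] contradicts the bound, since [n * N (a n) + 1] exceeds [C * N (a n)]. *)
have /archi_boundP := ltW C0; set n := Num.bound _ => Cn.
have := fC (a n); rewrite -aP fe.
rewrite ger0_norm ?ler0c ?addr_ge0 ?mulr_ge0 ?anorm_ge0//.
rewrite lecR leNgt => /negP; apply.
by rewrite (le_lt_trans (ler_wpM2r (anorm_ge0 _ _) (ltW Cn)))// ltrDl.
Qed.

Lemma dense_square_full (N : algebra_norm A) :
  (forall M M' : algebra_norm A, norm_equiv M M') ->
  dense (alg_square A : set (normed_by N)) -> alg_square A = [set: A].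
Proof.
move=> allequiv dA; rewrite -subTset => a _; apply: contrapT => aA.
have /functional_nonzero[f fa] : lquot_pi (products A) a != 0.
  by apply/eqP => /lquot_pi_eq0.
have [C C0 fC] := lquot_functional_bounded N f allequiv.
(* The radius [C^-1] forces [|f|] below 1 at [a - b], whereas for [b] in [A^2] the value there is
   the one at [a], namely 1. *)
pose U : set (normed_by N) := [set b | N (a - b) < C^-1].
have oU : open U.
  apply/open_anormP => b Ub; exists (C^-1 - N (a - b)); rewrite ?subr_gt0//.
  move=> c; rewrite ltrBrDl; apply: le_lt_trans.
  by rewrite -[X in N X](subrKA b) anormD.
have [|b [Ub Ab]] := dA U _ oU.
  by exists a; rewrite /U /= subrr anorm0 invr_gt0.
have : `|f (lquot_pi _ (a - b))| < 1.
  apply: le_lt_trans (fC _) _; rewrite ltcR.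
  by rewrite -(mulfV (lt0r_neq0 C0)) ltr_pM2l.
rewrite (_ : lquot_pi _ (a - b) = lquot_pi _ a) ?fa ?normr1 ?ltxx//.
apply/lquot_piP; rewrite addrAC subrr sub0r rpredN.
exact/asboolP.
Qed.

End FunctionalsVanishingOnSquare.

(** * Norms on the null product *)

Section NullProductNorms.
Variables (R : realType) (A : assocAlgType R[i]).

Let inA (a : A) : null_product A := (a, 0).
Let unit0 : null_product A := (0, 1).

Lemma null_productE (x : null_product A) : x = inA x.1 + x.2 *: unit0.
Proof.
case: x => a z; congr (_, _); rewrite /= ?scaler0 ?addr0//.
by rewrite add0r [_ *: _]mulr1.
Qed.

Lemma null_product_restriction (P : algebra_norm (null_product A)) :
  exists N : algebra_norm A, forall a, N a = P (inA a).
Proof.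
pose p a := P (inA a).
have p0 a : p a = 0 -> a = 0 by move=> /anorm_eq0 [].
have pD a b : p (a + b) <= p a + p b.
  rewrite /p (_ : inA _ = inA a + inA b); first exact: anormD.
  by congr (_, _); rewrite /= addr0.
have pZ k a : (p (k *: a))%:C = `|k| * (p a)%:C.
  rewrite /p (_ : inA _ = k *: inA a); first exact: anormZ.
  by congr (_, _); rewrite /= scaler0.
have pM a b : p (amul a b) <= p a * p b by exact: (anormM P (inA a) (inA b)).
by exists (AlgebraNorm p0 pD pZ pM).
Qed.

(** The second coordinate is a linear functional that vanishes on products and detects the nonzero
    vectors killed by [N x.1]. *)
Lemma null_product_extension (N : algebra_norm A) :
  exists P : algebra_norm (null_product A),
    forall x, P x = N x.1 + ComplexField.Normc.normc x.2.
Proof.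
apply: (@seminorm_add_functional R (null_product A) (fun x => N x.1) snd).
- by move=> x; exact: anorm_ge0.
- by move=> x y; exact: anormD.
- by move=> k x; exact: anormZ.
- by move=> x y; exact: anormM.
- by [].
- by [].
- by move=> [a z] /= /anorm_eq0 -> ->.
Qed.

(* Otherwise some [(u n, 1)] tends to [0], so [u] is Cauchy, and its limit [a]
   gives the null vector [(a, 1)]. *)
Lemma null_product_unit_distance (P : algebra_norm (null_product A))
    (N : algebra_norm A) (C D : R) :
  norm_complete N -> 0 < C -> 0 < D ->
  (forall a, N a <= C * P (inA a)) -> (forall a, P (inA a) <= D * N a) ->
  exists2 d : R, 0 < d & forall a, d <= P (inA a + unit0).
Proof.
move=> Ncomp C0 D0 NP PN; apply: contrapT => nod.
have /choice[u uP] (n : nat) : exists a, P (inA a + unit0) < n.+1%:R^-1.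
  apply: contrapT => /forallNP dP; apply: nod; exists n.+1%:R^-1.
    by rewrite invr_gt0.
  by move=> a; rewrite leNgt; apply/negP; exact: dP.
have small (e : R) : 0 < e ->
    exists k, forall n, (k <= n)%N -> P (inA (u n) + unit0) < e.
  move=> e0; have [k _ kP] := near_infty_natSinv_lt (PosNum e0).
  by exists k => n /kP /=; exact: lt_trans.
have inAB a b : inA (a - b) = inA a + unit0 - (inA b + unit0).
  by congr (_, _); rewrite /= ?addr0 // subrr.
have [|a ua] := norm_complete_seq Ncomp (u := u).
  (* Two vectors of [P]-size below [e / (2 * C)] differ by less than [e / C], and passing from [P]
     to [N] costs a factor [C]. *)
  move=> e e0; have [|k kP] := small (e / (2 * C)).
    by rewrite divr_gt0// mulr_gt0.
  exists k => n kn; apply: le_lt_trans (NP _) _.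
  rewrite mulrC -ltr_pdivlMr// inAB.
  apply: le_lt_trans (anormD _ _ _) _; rewrite anormN.
  have -> : e / C = e / (2 * C) + e / (2 * C).
    by rewrite invfM mulrA -mulrDl -splitr.
  by rewrite ltrD// kP.
have : P (inA a + unit0) = 0.
  apply/eqP; rewrite eq_le anorm_ge0 andbT; apply/ler_addgt0Pl => e e0.
  rewrite addr0.
  have e2 : 0 < e / 2 by rewrite divr_gt0.
  have [k1 k1P] := small _ e2.
  (* Half of [e] pays for [a - u n], where passing from [N] to [P] costs a factor [D]; the other
     half pays for [(u n, 1)]. *)
  have [|k2 k2P] := ua (e / 2 / D); first by rewrite divr_gt0.
  pose n := maxn k1 k2.
  rewrite -(subrK (inA (u n) + unit0) (inA a + unit0)) -inAB.
  apply: le_trans (anormD _ _ _) _; rewrite [leRHS]splitr lerD//.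
    apply: le_trans (PN _) _; rewrite mulrC -ler_pdivlMr//.
    by rewrite ltW// k2P// leq_maxr.
  by rewrite ltW// k1P// leq_maxl.
by move=> /anorm_eq0[_ /eqP]; rewrite add0r oner_eq0.
Qed.

(** By transitivity, each norm need only be compared with the reference norm [N x.1 + |x.2|]. The
    distance [d] controls the second coordinate, and subtracting that part controls the first. *)
Lemma null_product_norms_equiv (N : algebra_norm A) :
  norm_complete N -> (forall M M' : algebra_norm A, norm_equiv M M') ->
  forall P P' : algebra_norm (null_product A), norm_equiv P P'.
Proof.
move=> Ncomp allequiv.
have [Q QE] := null_product_extension N.
suff PQ P : norm_equiv P Q.
  by move=> P P'; exact: norm_equiv_trans (PQ P) (norm_equiv_sym (PQ P')).
have [r rE] := null_product_restriction P.
have [C C0 NP] := norm_equiv_dominated (allequiv N r).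
have [D D0 PN] := norm_equiv_dominated (allequiv r N).
have [d d0 dP] : exists2 d : R, 0 < d & forall a, d <= P (inA a + unit0).
  by apply: (null_product_unit_distance Ncomp C0 D0) => a; rewrite -rE.
have normcE (z : R[i]) : (ComplexField.Normc.normc z)%:C = `|z| by [].
have PZ z x : P (z *: x) = ComplexField.Normc.normc z * P x.
  by apply: complexI; rewrite anormZ rmorphM.
have normc_ge0 (z : R[i]) : 0 <= ComplexField.Normc.normc z.
  by rewrite -lecR normcE normr_ge0.
have normc_le x : d * ComplexField.Normc.normc x.2 <= P x.
  have [->|x2] := eqVneq x.2 0.
    by rewrite ComplexField.Normc.normc0 mulr0 anorm_ge0.
  (* Dividing by [x.2] moves [x] to the hyperplane of second coordinate 1, where [P] is at least
     [d]. *)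
  have xE : x = x.2 *: (inA (x.2^-1 *: x.1) + unit0).
    rewrite [LHS]null_productE scalerDr; congr (_ + _).
    by congr (_, _); rewrite /= ?scaler0// scalerA mulfV// scale1r.
  by rewrite [X in _ <= P X]xE PZ mulrC ler_wpM2l.
(* The second constant adds up the bounds [|x.2| <= d^-1 * P x] and
   [N x.1 <= C * P (x - x.2 *: unit0)]. *)
apply: (@norm_equiv_of_dominated _ _ P Q (D + P unit0)
    (C * (1 + d^-1 * P unit0) + d^-1)).
- by rewrite ltr_wpDr ?anorm_ge0.
- rewrite addr_gt0 ?invr_gt0// mulr_gt0// ltr_wpDr//.
  by rewrite mulr_ge0 ?anorm_ge0// invr_ge0 ltW.
- move=> x; rewrite QE [X in P X]null_productE.
  apply: le_trans (anormD _ _ _) _; rewrite PZ mulrDl lerD//.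
    by rewrite -rE (le_trans (PN _))// ler_wpM2l ?(ltW D0)// lerDl.
  by rewrite mulrC ler_wpM2l ?anorm_ge0// lerDr anorm_ge0.
- move=> x; rewrite QE mulrDl.
  have x2P : ComplexField.Normc.normc x.2 <= d^-1 * P x.
    by rewrite mulrC ler_pdivlMr// mulrC normc_le.
  rewrite lerD// (le_trans (NP _))// -mulrA ler_wpM2l ?(ltW C0)// rE.
  have -> : inA x.1 = x - x.2 *: unit0.
    by rewrite [X in X - _]null_productE addrK.
  apply: le_trans (anormD _ _ _) _; rewrite anormN PZ mulrDl mul1r lerD2l.
  by rewrite mulrAC ler_wpM2r// anorm_ge0.
Qed.

End NullProductNorms.

Theorem corollary2p18 (R : realType) (A : assocAlgType R[i])
    (hN : is_singleton (alg_norms A))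
    (hNc : is_singleton (complete_alg_norms A)) :
  [/\ is_singleton (alg_norms (null_product A)),
      finite_codim_square A &
      forall N : algebra_norm A,
        dense (alg_square A : set (normed_by N)) ->
        alg_square A = [set: A] ].
Proof.
have [_ allequiv] := (is_singleton_norm_classesP _).1 hN.
(* The complete norm obtained here feeds the limit argument for the null product. *)
have [[N Ncomp] _] := (is_singleton_norm_classesP _).1 hNc.
have {}allequiv (M M' : algebra_norm A) : norm_equiv M M' :=
  allequiv M M' I I.
split; last by move=> M; exact: dense_square_full.
- apply/is_singleton_norm_classesP; split.
    by have [P _] := null_product_extension N; exists P.
  by move=> P P' _ _; exact: null_product_norms_equiv Ncomp allequiv P P'.
- exact: finite_codim_square_of_equiv N allequiv.
Qed.
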